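(* Let $M$ be a finite, loopless, connected matroid with at least two elements. Then $a(M)\leq c^*_e(M)$ for every $e\in E(M)$.
   Context: The arboricity $a(M)$ of a loopless matroid $M$ is the minimum number of independent sets into which $E(M)$ can be partitioned. For $e\in E(M)$, the $e$-cocircumference $c^*_e(M)$ is the size of a largest cocircuit of $M$ containing $e$. *)

(* Defs.v *)
From mathcomp Require Import all_boot.

Set Implicit Arguments.
Unset Strict Implicit.
Unset Printing Implicit Defensive.

(* The ground set E(M) is the whole finite type T. *)
Record matroid (T : finType) := Matroid {
  indep : pred {set T};
  indep0 : indep set0;
  indepS : forall I J : {set T}, I \subset J -> indep J -> indep I;
  indep_aug : forall I J : {set T}, indep I -> indep J -> #|I| < #|J| ->
    exists2 x, x \in J :\: I & indep (x |: I) }.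

Section Bases.
Variables (T : finType) (M : matroid T).
Implicit Types I J B C : {set T}.

Definition basis B := maxset (indep M) B.

Definition circuit C := minset (fun I => ~~ indep M I) C.

Lemma basis_indep B : basis B -> indep M B.
Proof. exact: maxsetp. Qed.

Lemma indep_leq_basis I B : indep M I -> basis B -> #|I| <= #|B|.
Proof.
move=> hI hB; rewrite leqNgt; apply/negP => lt.
have [x] := indep_aug (basis_indep hB) hI lt.
rewrite inE => /andP[/negP xB _] hx; apply: xB.
by rewrite -(maxsetsup hB hx (subsetUr _ _)) setU11.
Qed.

Lemma basis_card_eq B C : basis B -> basis C -> #|B| = #|C|.
Proof.
move=> hB hC; apply/eqP; rewrite eqn_leq.
by rewrite !indep_leq_basis ?basis_indep.
Qed.

Lemma indep_basis I B : basis B -> indep M I -> #|B| <= #|I| -> basis I.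
Proof.
move=> hB hI le; apply/maxsetP; split=> // J hJ sIJ.
by apply/esym/eqP; rewrite eqEcard sIJ (leq_trans (indep_leq_basis hJ hB)).
Qed.

Lemma basis_exists : exists B, basis B.
Proof. by have [B hB _] := maxset_exists (indep0 M); exists B. Qed.

Lemma indep_extend I B : indep M I -> basis B ->
  exists K, [/\ basis K, I \subset K & K \subset I :|: B].
Proof.
move=> hI hB; pose P K := indep M K && (K \subset I :|: B).
have PI : P I by rewrite /P hI subsetUl.
have [K /maxsetP[/andP[hK sK] maxK] sIK] := maxset_exists PI.
exists K; split=> //; apply: (indep_basis hB hK).
rewrite leqNgt; apply/negP => lt.
have [x] := indep_aug hK (basis_indep hB) lt.
rewrite inE => /andP[/negP xK xB] hx; apply: xK.
rewrite -(maxK (x |: K)) ?setU11 ?subsetUr // /P hx subUset sK andbT.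
by rewrite sub1set inE xB orbT.
Qed.

Definition coindep I := [exists B, basis B && [disjoint I & B]].

Lemma coindepP I :
  reflect (exists2 B, basis B & [disjoint I & B]) (coindep I).
Proof.
by apply: (iffP existsP) => [[B /andP[]]|[B hB dB]]; exists B => //; apply/andP.
Qed.

Lemma coindep0 : coindep set0.
Proof.
have [B hB] := basis_exists; apply/coindepP; exists B => //.
by rewrite -setI_eq0 set0I.
Qed.

Lemma coindepS I J : I \subset J -> coindep J -> coindep I.
Proof.
move=> sIJ /coindepP[B hB dB]; apply/coindepP; exists B => //.
exact: disjointWl sIJ dB.
Qed.

Lemma coindep_aug I J : coindep I -> coindep J -> #|I| < #|J| ->
  exists2 x, x \in J :\: I & coindep (x |: I).
Proof.
move=> /coindepP[B1 hB1 d1] /coindepP[B2 hB2 d2] lt.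
have hBI : indep M (B2 :\: I) by apply: indepS (basis_indep hB2); apply: subsetDl.
have [B [hB sB Bs]] := indep_extend hBI hB1.
have dB : [disjoint I & B].
  rewrite disjoint_sym; apply: disjointWl Bs _.
  rewrite -setI_eq0 setIUl setU_eq0 !setI_eq0 [[disjoint B1 & I]]disjoint_sym d1.
  by rewrite andbT -setI_eq0 setIDAC setDIl setDv setI0.
have [sJB|/subsetPn[x xJ xB]] := boolP (J :\: I \subset B); last first.
  exists x => //; apply/coindepP; exists B => //.
  by rewrite -setI_eq0 setIUl setU_eq0 !setI_eq0 dB disjoints1 xB.
have dJ : [disjoint B2 :\: I & J :\: I].
  rewrite disjoint_sym; apply: disjointW d2; exact: subsetDl.
have sU : (B2 :\: I) :|: (J :\: I) \subset B by rewrite subUset sB.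
have := subset_leq_card sU; rewrite cardsU.
move: dJ; rewrite -setI_eq0 => /eqP->; rewrite cards0 subn0.
rewrite (basis_card_eq hB hB2) -(cardsID I B2) addnC leq_add2r => le.
have sI : B2 :&: I \subset I :\: J.
  apply/subsetP=> y; rewrite !inE => /andP[yB ->]; rewrite andbT.
  by apply/negP=> yJ; rewrite (disjointFr d2 yJ) in yB.
have := leq_trans le (subset_leq_card sI).
rewrite -(leq_add2l #|I :&: J|) cardsID setIC cardsID.
by rewrite leqNgt lt.
Qed.

Definition dual := Matroid coindep0 coindepS coindep_aug.

End Bases.

Section Invariants.
Variables (T : finType) (M : matroid T).

Definition cocircuit (C : {set T}) := circuit (dual M) C.

Definition loop (x : T) := circuit M [set x].

Definition loopless := forall x : T, ~~ loop x.

Definition connected := forall x y : T, x != y ->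
  exists C : {set T}, [/\ circuit M C, x \in C & y \in C].

Definition indep_partition (P : {set {set T}}) :=
  partition P [set: T] && [forall I in P, indep M I].

(* The seed #|T| of the minimum is the size of the partition into singletons,
   which is a partition into independent sets when M is loopless. For a matroid
   with loops there is no such partition and the value is meaningless. *)
Definition arboricity :=
  \big[minn/#|T|]_(P : {set {set T}} | indep_partition P) #|P|.

(* This is 0 if no cocircuit contains e, i.e., if e is a loop. *)
Definition ecocircumference (e : T) :=
  \max_(C : {set T} | cocircuit C && (e \in C)) #|C|.

Lemma loopless_indep1 x : loopless -> indep M [set x].
Proof.
move=> /(_ x); apply: contraR => dx; apply/minsetP; split=> // B dB.
rewrite subset1 => /orP[/eqP //|/eqP B0].
by rewrite B0 indep0 in dB.
Qed.

Lemma arboricity_attained : loopless ->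
  exists2 P, indep_partition P & #|P| = arboricity.
Proof.
move=> hM; rewrite /arboricity.
apply: (big_ind (fun n => exists2 P, indep_partition P & #|P| = n)).
- exists [set [set x] | x : T]; last by rewrite card_imset //; apply: set1_inj.
  apply/andP; split; last first.
    by apply/forall_inP=> _ /imsetP[x _ ->]; apply: loopless_indep1.
  apply/and3P; split.
  + apply/eqP/setP=> x; rewrite inE; apply/bigcupP; exists [set x].
      exact: imset_f.
    by rewrite inE.
  + apply/trivIsetP=> _ _ /imsetP[x _ ->] /imsetP[y _ ->] ne.
    by rewrite disjoints1 inE; apply: contraNneq ne => ->.
  + by apply/imsetP=> -[x _ /setP/(_ x)]; rewrite !inE eqxx.
- by move=> m n hm hn; rewrite /minn; case: ifP.
- by move=> P hP; exists P.
Qed.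

Lemma arboricity_min P : indep_partition P -> arboricity <= #|P|.
Proof.
move=> hP; rewrite /arboricity.
elim: (index_enum _) (mem_index_enum P) => // Q s IH; rewrite inE big_cons.
case/predU1P=> [<-|/IH le]; first by rewrite hP geq_minl.
by case: ifP => // _; rewrite geq_min le orbT.
Qed.

Lemma cocircuit_exists e : indep M [set e] ->
  exists2 C, cocircuit C & e \in C.
Proof.
move=> he; have [B0 hB0] := basis_exists M.
have [B [hB]] := indep_extend he hB0; rewrite sub1set => eB _.
have dep : ~~ indep (dual M) (e |: ~: B).
  apply/coindepP=> -[B' hB' dB'].
  have sB' : B' \subset B :\ e.
    apply/subsetP=> y yB'; rewrite !inE.
    by have := disjointFl dB' yB'; rewrite !inE => /norP[-> /negPn].
  have := leq_trans (subset_leq_card sB') (leqnn _).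
  by rewrite (basis_card_eq hB' hB) [#|B|](cardsD1 e) eB ltnn.
have [C hC sC] := minset_exists (P := fun I => ~~ indep (dual M) I) dep; exists C => //.
apply: contraT => eC; have /negP[] := minsetp hC.
apply/coindepP; exists B => //; rewrite disjoints_subset.
apply/subsetP=> y yC; have := subsetP sC _ yC; rewrite !inE.
by case: eqP => // ye; rewrite -ye yC in eC.
Qed.

End Invariants.

(* Main.v *)
Require Import Defs.
From mathcomp Require Import all_boot.

(** The elements outside a cocircuit D form a hyperplane, so an independent set
    avoiding D stays independent when any one element of D is added.  Hence, if
    #|D| <= k, a colouring of X :\: D with k independent classes extends to X by
    giving the elements of D pairwise distinct colours.  In a connected matroid
    every element lies with e in a common cocircuit, so every set can be
    exhausted by cocircuits through e, and k can be taken to be the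
    e-cocircumference. *)

Section CocircuitColouring.
Set Implicit Arguments.
Unset Strict Implicit.
Variables (T : finType) (M : matroid T).
Implicit Types (X B C D I : {set T}) (x y e f : T).

Lemma cocircuit_basis_meet B D : cocircuit M D -> basis M B -> ~~ [disjoint D & B].
Proof.
move=> /minsetp /negP hD hB; apply/negP => dB; apply: hD.
by apply/coindepP; exists B.
Qed.

(** By minimality of [D], some basis [B] avoids [D :\ x]. Extend [I] to a basis [K] inside
    [I :|: B]: it must meet [D], and can do so only at [x], so [K] contains [x |: I]. *)
Lemma indep_setU1_cocircuit I D x :
  cocircuit M D -> indep M I -> [disjoint I & D] -> x \in D -> indep M (x |: I).
Proof.
move=> hD hI dID xD.
have : indep (dual M) (D :\ x).
  apply: contraT => dep; have /minsetP[_ minD] := hD.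
  by have /setP/(_ x) := minD _ dep (subsetDl _ _); rewrite !inE eqxx xD.
case/coindepP=> B hB dB; have [K [hK sIK sK]] := indep_extend hI hB.
have /pred0Pn[y /andP[/= yD yK]] := cocircuit_basis_meet hD hK.
have yx : y = x.
  apply/eqP; apply: contraT => nyx.
  have /setUP[yI|yB] := subsetP sK _ yK; first by rewrite (disjointFr dID yI) in yD.
  by have := disjointFl dB yB; rewrite !inE nyx yD.
by apply: indepS (basis_indep hK); rewrite subUset sub1set sIK -yx yK.
Qed.

(* The cocircuit is the fundamental one of f in a basis extending C :\ e; if it
   missed e, it would meet C in f alone. *)
Lemma circuit_cocircuit C e f : circuit M C -> e != f -> e \in C -> f \in C ->
  exists D, [/\ cocircuit M D, e \in D & f \in D].
Proof.
move=> hC nef eC fC; have /minsetP[depC minC] := hC.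
have indepD1 x : x \in C -> indep M (C :\ x).
  move=> xC; apply: contraT => dep.
  by have /setP/(_ x) := minC _ dep (subsetDl _ _); rewrite !inE eqxx xC.
have [B0 hB0] := basis_exists M.
have [B [hB sCB _]] := indep_extend (indepD1 e eC) hB0.
have [|D hD sD] := minset_exists (P := fun I => ~~ indep (dual M) I) (C := f |: ~: B).
  apply/coindepP=> -[B' hB' dB'].
  have sB' : B' \subset B :\ f.
    apply/subsetP=> y yB'; rewrite !inE.
    by have := disjointFl dB' yB'; rewrite !inE => /norP[-> /negPn].
  have fB : f \in B by rewrite (subsetP sCB) // !inE eq_sym nef.
  have := subset_leq_card sB'.
  by rewrite (basis_card_eq hB' hB) [#|B|](cardsD1 f) fB ltnn.
(* [D] meets [B], and [f] is the only element of [f |: ~: B] in [B]. *)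
have /pred0Pn[y /andP[/= yD yB]] := cocircuit_basis_meet hD hB.
have fD : f \in D.
  by have := subsetP sD _ yD; rewrite !inE yB orbF => /eqP <-.
exists D; split=> //; apply: contraT => eD; case/negP: depC.
rewrite -(setD1K fC); apply: (indep_setU1_cocircuit hD) => //; first exact: indepD1.
rewrite disjoints_subset; apply/subsetP=> z; rewrite !inE => /andP[nzf zC].
apply/negP=> zD; have := subsetP sD _ zD; rewrite !inE (negPf nzf) /= => /negP; apply.
rewrite (subsetP sCB) // !inE zC andbT.
by apply: contraNneq eD => <-.
Qed.

Lemma cocircuit_cover_colouring k :
    (forall x, exists D, [/\ cocircuit M D, x \in D & #|D| <= k]) ->
  forall X, exists c : T -> nat, {in X, forall x, c x < k} /\
    forall j, indep M [set x in X | c x == j].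
Proof.
move=> cov X; have [n] := ubnP #|X|; elim: n => // n IHn in X *.
have [-> _|[f fX] ltXn] := set_0Vmem X.
  exists (fun=> 0); split=> [x|j]; first by rewrite inE.
  by apply: indepS (indep0 M); apply/subsetP=> x; rewrite !inE.
have [D [hD fD leDk]] := cov f.
have /IHn[c [ck ci]] : #|X :\: D| < n.
  rewrite -ltnS (leq_trans _ ltXn) // ltnS proper_card // properE subsetDl.
  by apply/subsetPn; exists f; rewrite // !inE fD.
(* Positions in [enum D] are distinct and below [#|D| <= k]. They may repeat colours used by [c] off
   [D]: each old class gains at most one element. *)
pose c' x := if x \in D then index x (enum D) else c x.
exists c'; split=> [x xX | j].
  rewrite /c'; case: ifP => xD; last by apply: ck; rewrite !inE xD.
  by apply: leq_trans leDk; rewrite cardE index_mem mem_enum.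
(* Only an inclusion of the new class in [d |:] the old one is needed, as [d] may lie outside
   [X]. *)
have [/existsP[d /andP[dD /eqP dj]]|noD] :=
    boolP [exists d, (d \in D) && (index d (enum D) == j)].
  apply: (indepS (J := d |: [set x in X :\: D | c x == j])).
    apply/subsetP=> x; rewrite !inE /c' => /andP[xX].
    case: ifP => [xD|_ ->]; last by rewrite xX orbT.
    rewrite -dj => /eqP eq_ix; apply/orP; left; apply/eqP.
    by apply: (index_inj x) eq_ix; rewrite mem_enum.
  apply: (indep_setU1_cocircuit hD) => //.
  by rewrite disjoints_subset; apply/subsetP=> x; rewrite !inE => /andP[/andP[]].
apply: indepS (ci j); apply/subsetP=> x; rewrite !inE /c' => /andP[-> /=].
case: ifP => [xD xj|_ ->] //; case/existsP: noD; exists x; exact/andP.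
Qed.

Lemma arboricity_colouring k (c : T -> nat) :
    (forall x, c x < k) -> (forall j, indep M [set x | c x == j]) ->
  arboricity M <= k.
Proof.
move=> ck ci; pose P := preim_partition c [set: T].
have sP : P \subset [set [set x | c x == j] | j : 'I_k].
  apply/subsetP=> _ /imsetP[x _ ->]; apply/imsetP; exists (Ordinal (ck x)) => //.
  by apply/setP=> y; rewrite !inE eq_sym.
have /arboricity_min le : indep_partition M P.
  rewrite /indep_partition preim_partitionP; apply/forall_inP=> I IP.
  by have /imsetP[j _ ->] := subsetP sP _ IP.
apply: leq_trans le (leq_trans (subset_leq_card sP) _).
by apply: leq_trans (leq_imset_card _ _) _; rewrite card_ord.
Qed.

End CocircuitColouring.

Theorem theorem1p5 (T : finType) (M : matroid T)
    (hloop : loopless M) (hconn : connected M) (hcard : 2 <= #|T|) (e : T) :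
  arboricity M <= ecocircumference M e.
Proof.
have cov x : exists D, [/\ cocircuit M D, x \in D & #|D| <= ecocircumference M e].
  have [D [hD eD xD]] : exists D, [/\ cocircuit M D, e \in D & x \in D].
    (* Connectedness concerns distinct elements only; for [x = e] a cocircuit exists because [e] is
       not a loop. *)
    have [<-|nex] := eqVneq e x.
      by have [D hD eD] := cocircuit_exists (loopless_indep1 e hloop); exists D.
    have [C [hC eC xC]] := hconn _ _ nex.
    exact: circuit_cocircuit hC nex eC xC.
  by exists D; split=> //; apply: leq_bigmax_cond; rewrite hD.
have [c [ck ci]] := cocircuit_cover_colouring cov [set: T].
apply: (arboricity_colouring (c := c)) => [x|j]; first exact: ck.
by apply: indepS (ci j); apply/subsetP=> x; rewrite !inE.
Qed.
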